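(* Let $G=(V,E)$ be a hypergraph, let $\{w_A\}_{A\in E}$, $\{\lambda_A\}_{A\in E}$ and ${\bf t}=(t_i)_{i\in V}$ be complex numbers. Then $$\int \mathcal{D}(\psi,\bar\psi)\,\exp\Big[\sum_{i\in V} t_i\bar\psi_i\psi_i+\sum_{A\in E} w_A f_A^{(\lambda_A)}\Big]=\sum_{\substack{F\in\mathcal{F}(G)\\ F=(F_1,\ldots,F_\ell)}}\Big(\prod_{A\in F}w_A\Big)\prod_{\alpha=1}^{\ell}\Big(\sum_{i\in V(F_\alpha)}t_i-\sum_{A\in E(F_\alpha)}(|A|-1)\lambda_A\Big).$$ In particular, if $\lambda_A=\lambda$ for all $A\in E$, $$\int \mathcal{D}(\psi,\bar\psi)\,\exp\Big[\sum_{i} t_i\bar\psi_i\psi_i+\sum_{A\in E} w_A f_A^{(\lambda)}\Big]=\sum_{\substack{F\in\mathcal{F}(G)\\ F=(F_1,\ldots,F_\ell)}}\Big(\prod_{A\in F}w_A\Big)\prod_{\alpha=1}^{\ell}\Big(\lambda+\sum_{i\in V(F_\alpha)}(t_i-\lambda)\Big).$$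
   Context: A hypergraph is a pair $G=(V,E)$ with $V$ a finite set and $E$ a set (no repetitions) of subsets of $V$, each of cardinality at least 2 (hyperedges). A walk is a sequence $(v_0,e_1,v_1,\ldots,e_k,v_k)$ with $v_i\in V$, $e_i\in E$, $v_{i-1},v_i\in e_i$; $G$ is connected if any two vertices are joined by a walk; connected components are the maximal connected subhypergraphs (isolated vertices are components). A cycle is a walk with $v_0,\ldots,v_{k-1}$ distinct, $v_k=v_0$, $e_1,\ldots,e_k$ distinct, and $k\ge 2$. A hyperforest is a hypergraph with no cycles; a hypertree is a connected hyperforest. A spanning hyperforest of $G$ is a subset $F\subseteq E$ such that $(V,F)$ is a hyperforest; $\mathcal{F}(G)$ is the set of these; its components $F_1,\ldots,F_\ell$ are the connected components of $(V,F)$, with vertex sets $V(F_\alpha)$ and hyperedge sets $E(F_\alpha)$. Grassmann setting: for each $i\in V$ there are anticommuting generators $\psi_i,\bar\psi_i$ of a Grassmann algebra over $\mathbb{C}$. For $A\subseteq V$, $\tau_A=\prod_{i\in A}\bar\psi_i\psi_i$ ($\tau_\emptyset=1$), and for $\lambda\in\mathbb{C}$, $$f_A^{(\lambda)}=\lambda(1-|A|)\tau_A+\sum_{i\in A}\tau_{A\setminus\{i\}}-\sum_{i,j\in A,\ i\neq j}\bar\psi_i\psi_j\,\tau_{A\setminus\{i,j\}}.$$ Berezin integration: $\mathcal{D}(\psi,\bar\psi)=\prod_{i\in V}d\psi_i\,d\bar\psi_i$, with the convention $\int d\psi_i\,d\bar\psi_i\,\bar\psi_i\psi_i=1$ and $\int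 d\psi_i\,d\bar\psi_i\,m=0$ for monomials $m$ in $\psi_i,\bar\psi_i$ of lower degree. The exponential of an even element is defined by its (finite) power series. *)

(* Defs.v *)
From HB Require Import structures.
From mathcomp Require Import all_boot all_order all_algebra complex.
From mathcomp Require Import boolp reals.

Set Implicit Arguments.
Unset Strict Implicit.
Unset Printing Implicit Defensive.

Import Order.TTheory GRing.Theory Num.Theory.
Local Open Scope ring_scope.

Section Hypergraph.
Variable T : finType.

Definition is_hypergraph (E : {set {set T}}) : Prop :=
  forall A, A \in E -> (1 < #|A|)%N.

(** Two vertices are adjacent in (V,F) if some hyperedge of F contains both;
    walks are paths of this relation, so "joined by a walk" is [connect]. *)
Definition hadj (F : {set {set T}}) : rel T :=
  fun x y => [exists A in F, (x \in A) && (y \in A)].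

Definition hcycle (F : {set {set T}}) (k : nat)
    (v : 'I_k -> T) (e : 'I_k -> {set T}) : Prop :=
  [/\ (2 <= k)%N, injective v, injective e &
      forall i : 'I_k, [/\ e i \in F, v i \in e i & v (ordS i) \in e i]].

Definition hyperforest (F : {set {set T}}) : Prop :=
  forall (k : nat) (v : 'I_k -> T) (e : 'I_k -> {set T}), ~ hcycle F v e.

Definition spanning_forests (E : {set {set T}}) : {set {set {set T}}} :=
  [set F : {set {set T}} | (F \subset E) && `[< hyperforest F >]].

(** Vertex sets of the connected components of (V,F). The hyperedge set of the
    component with vertex set C is [set A in F | A \subset C]. *)
Definition components (F : {set {set T}}) : {set {set T}} :=
  [set [set y | connect (hadj F) x y] | x : T].

End Hypergraph.

Section Grassmann.
Variables (T : finType) (C : fieldType).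

(** Generators: (false, i) is psibar_i, (true, i) is psi_i. They are totally
    ordered by enum_rank; an element of the Grassmann algebra is the family of
    its coefficients on the ordered monomials e_S (S a set of generators). *)
Local Notation gen := (bool * T)%type.
Local Notation grass := {ffun {set gen} -> C}.

(** sign of e_S e_U = sign * e_(S u U) for disjoint S, U. *)
Definition gsign (S U : {set gen}) : C :=
  (-1) ^+ #|[set p in setX S U | (enum_rank p.2 < enum_rank p.1)%N]|.

Definition gmul (a b : grass) : grass :=
  [ffun W => \sum_(S : {set gen}) \sum_(U : {set gen} |
      [disjoint S & U] && (S :|: U == W)) gsign S U * a S * b U].

Definition gone : grass := [ffun W => (W == set0)%:R].
Definition ggen (g : gen) : grass := [ffun W => (W == [set g])%:R].
Definition gpsibar (i : T) : grass := ggen (false, i).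
Definition gpsi (i : T) : grass := ggen (true, i).

Definition gscale (c : C) (x : grass) : grass := [ffun W => c * x W].

Definition gpow (x : grass) (k : nat) : grass := iter k (gmul x) gone.

(** Exponential by its (finite) power series; for elements without constant
    term (the only ones used) all powers beyond #|gen| vanish. *)
Definition gexp (x : grass) : grass :=
  \sum_(k < #|{: gen}|.+1) gscale (k`!%:R)^-1 (gpow x k).

Definition tau (A : {set T}) : grass :=
  \big[gmul/gone]_(i in A) gmul (gpsibar i) (gpsi i).

Definition fA (lam : C) (A : {set T}) : grass :=
  gscale (lam * (1 - #|A|%:R)) (tau A)
  + \sum_(i in A) tau (A :\ i)
  - \sum_(i in A) \sum_(j in A | i != j)
        gmul (gmul (gpsibar i) (gpsi j)) (tau (A :\ i :\ j)).

(** Berezin integral with measure prod_i dpsi_i dpsibar_i and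
    int dpsi_i dpsibar_i psibar_i psi_i = 1: the coefficient of the top
    monomial prod_i psibar_i psi_i (= tau V). *)
Definition berezin (X : grass) : C :=
  X [set: gen] / (tau [set: T]) [set: gen].

End Grassmann.

(* Main.v *)
Require Import Defs.
From HB Require Import structures.
From mathcomp Require Import all_boot all_order all_algebra complex.
From mathcomp Require Import boolp reals.
From mathcomp Require Import ring zify.

(** Put m_ij = psibar_i psi_j. For r in A one has f_A^(0) = prod_(s in A \ r)
    (psibar_s - psibar_r)(psi_s - psi_r), so f_A^(0) acts as a delta function
    identifying all the generators indexed by A, and
    f_A^(0) + a tau_A = (1 + a m_rr) f_A^(0) =: g_A(a). Hence
    g_A(a) g_B(b) = g_(A u B)(a + b) if A and B share one vertex, and 0 if they
    share at least two. Since 1 + t_i m_ii = g_{i}(t_i), inserting the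
    hyperedges of F one at a time shows that
    prod_i (1 + t_i m_ii) prod_(A in F) g_A(c_A) vanishes unless F is a
    hyperforest, and is then the product over the components C of F of g_C at
    the sum of the t_i and c_A carried by C. As f_C^(0) has degree 2|C| - 2, the
    Berezin integral of such a product is the product of these arguments.
    Finally the terms of the exponent have square zero, so the exponential is a
    product of factors 1 + z, which expands over the subsets F of E. *)

Set Implicit Arguments.
Unset Strict Implicit.
Unset Printing Implicit Defensive.

Import Order.TTheory GRing.Theory Num.Theory.
Local Open Scope ring_scope.

(** * The Grassmann algebra as a ring, and its commutative even subring *)

Section GrassmannRing.
Variables (T : finType) (C : fieldType).
Local Notation gen := (bool * T)%type.
Local Notation gsign := (@gsign T C).
Local Notation gone := (@gone T C).
Implicit Types S U W P Q : {set gen}.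

(** The exponent of [gsign] as a double sum, so that bimultiplicativity of the sign is just the
    splitting of sums over disjoint unions. *)
Definition ninv (S U : {set gen}) : nat :=
  \sum_(s in S) \sum_(u in U) (enum_rank u < enum_rank s)%N.

Lemma gsignE S U : gsign S U = (-1) ^+ ninv S U.
Proof.
rewrite /gsign; congr (_ ^+ _).
rewrite /ninv pair_big_dep /= -sum1_card big_mkcond [RHS]big_mkcond /=.
apply: eq_bigr => -[s u] _; rewrite !inE /=.
by case: (s \in S); case: (u \in U); case: ltnP.
Qed.

Lemma big_setU_disjoint (I : finType) (A B : {set I}) (F : I -> nat) :
  [disjoint A & B] ->
  (\sum_(i in A :|: B) F i = \sum_(i in A) F i + \sum_(i in B) F i)%N.
Proof.
by move=> dAB; rewrite -bigU //; apply: eq_bigl => i; rewrite !inE.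
Qed.

Lemma gsignUl S U W : [disjoint S & U] ->
  gsign (S :|: U) W = gsign S W * gsign U W.
Proof. by move=> dSU; rewrite !gsignE -exprD /ninv big_setU_disjoint. Qed.

Lemma gsignUr S U W : [disjoint U & W] ->
  gsign S (U :|: W) = gsign S U * gsign S W.
Proof.
move=> dUW; rewrite !gsignE -exprD /ninv -big_split /=.
by congr (_ ^+ _); apply: eq_bigr => s _; rewrite big_setU_disjoint.
Qed.

(** For disjoint sets, each pair (s, u) is an inversion in exactly one of the two orders, so the two
    inversion numbers add up to #|S| * #|U|. *)
Lemma gsignC S U : [disjoint S & U] ->
  gsign U S = (-1) ^+ (#|S| * #|U|) * gsign S U.
Proof.
move=> dSU; have -> : (#|S| * #|U| = ninv U S + ninv S U)%N.
  rewrite /ninv [X in (X + _)%N]exchange_big -big_split /=.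
  rewrite -sum_nat_const; apply: eq_bigr => s sS.
  rewrite -big_split /= -sum1_card; apply: eq_bigr => u uU.
  have: s != u by apply: contraTneq uU => <-; rewrite (disjointFr dSU).
  by rewrite -(inj_eq enum_rank_inj) -val_eqE /=; case: ltngtP.
by rewrite !gsignE exprD -mulrA -expr2 sqrr_sign mulr1.
Qed.

(** Structure constants of the monomial basis. The default 0 frees the sums in [gmulE] from side
    conditions, so they can be exchanged at will. *)
Definition gcoef (S U W : {set gen}) : C :=
  if [disjoint S & U] && (S :|: U == W) then gsign S U else 0.

Lemma gmulE (a b : {ffun {set gen} -> C}) W :
  gmul a b W = \sum_S \sum_U gcoef S U W * a S * b U.
Proof.
rewrite ffunE; apply: eq_bigr => S _; rewrite big_mkcond.
by apply: eq_bigr => U _; rewrite /gcoef; case: ifP => // _; rewrite !mul0r.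
Qed.

(** Associativity on basis monomials. Both sides vanish unless P, Q, U are pairwise disjoint with
    union W; then both are the product of the signs of the three pairs (P, Q), (P, U), (Q, U). *)
Lemma gcoef_assoc P Q U W :
  \sum_S gcoef P Q S * gcoef S U W = \sum_S gcoef Q U S * gcoef P S W.
Proof.
have L (X Y : {set gen}) (g : {set gen} -> C) :
    \sum_S gcoef X Y S * g S = if [disjoint X & Y] then gsign X Y * g (X :|: Y) else 0.
  rewrite (bigD1 (X :|: Y)) //= big1 ?addr0; last first.
    by move=> S nS; rewrite /gcoef eq_sym (negPf nS) andbF mul0r.
  by rewrite /gcoef eqxx andbT; case: ifP; rewrite ?mul0r.
have dU (X Y Z : {set gen}) : [disjoint X & Y :|: Z] = [disjoint X & Y] && [disjoint X & Z].
  by rewrite -!setI_eq0 setIUr setU_eq0.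
rewrite !L /gcoef setUA dU [[disjoint P :|: Q & U]]disjoint_sym dU.
rewrite [[disjoint U & Q]]disjoint_sym [[disjoint U & P]]disjoint_sym.
case dPQ: [disjoint P & Q]; case dQU: [disjoint Q & U]; case dPU: [disjoint P & U];
  rewrite //= ?mulr0 //.
case: eqP => _; rewrite ?mulr0 //.
by rewrite gsignUl // gsignUr // !mulrA mulrC !mulrA.
Qed.

(** A separate name for the coefficient families, to carry the Grassmann product as ring
    multiplication. *)
Definition galg := {ffun {set gen} -> C}.
HB.instance Definition _ := GRing.Zmodule.on galg.

Lemma gmulA : associative (@gmul T C).
Proof.
move=> a b c; apply/ffunP => W; rewrite !gmulE.
transitivity (\sum_P \sum_Q \sum_U (\sum_S gcoef Q U S * gcoef P S W) * (a P * b Q * c U)).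
  apply: eq_bigr => P _; under eq_bigr => S _ do rewrite gmulE mulr_sumr.
  rewrite exchange_big; apply: eq_bigr => Q _ /=.
  under eq_bigr => S _ do rewrite mulr_sumr.
  rewrite exchange_big; apply: eq_bigr => U _ /=; rewrite mulr_suml.
  by apply: eq_bigr => S _; ring.
symmetry; under eq_bigr => S _.
  under eq_bigr => U _.
    rewrite gmulE mulr_sumr mulr_suml.
    under eq_bigr => P _ do rewrite mulr_sumr mulr_suml.
    over.
  rewrite exchange_big /=.
  under eq_bigr => P _ do rewrite exchange_big /=.
  over.
rewrite exchange_big; apply: eq_bigr => P _ /=.
rewrite exchange_big; apply: eq_bigr => Q _ /=.
rewrite exchange_big; apply: eq_bigr => U _ /=.
rewrite -gcoef_assoc mulr_suml; apply: eq_bigr => S _; ring.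
Qed.

Lemma gsign0l S : gsign set0 S = 1.
Proof. by rewrite gsignE /ninv big_set0. Qed.

Lemma gsign0r S : gsign S set0 = 1.
Proof. by rewrite gsignE /ninv big1 // => s _; rewrite big_set0. Qed.

Lemma gmul1g : left_id gone (@gmul T C).
Proof.
move=> a; apply/ffunP => W; rewrite gmulE (bigD1 set0) //= [X in _ + X]big1 ?addr0; last first.
  by move=> S nS; rewrite big1 // => U _; rewrite ffunE (negPf nS) mulr0 mul0r.
rewrite (bigD1 W) //= big1 ?addr0 => [|U nU].
  by rewrite /gcoef set0U eqxx -setI_eq0 set0I eqxx /= gsign0l ffunE eqxx !mul1r.
by rewrite /gcoef set0U (negPf nU) andbF !mul0r.
Qed.

Lemma gmulg1 : right_id gone (@gmul T C).
Proof.
move=> a; apply/ffunP => W; rewrite gmulE exchange_big (bigD1 set0) //= [X in _ + X]big1 ?addr0; last first.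
  by move=> S nS; rewrite big1 // => U _; rewrite [gone _]ffunE (negPf nS) mulr0.
rewrite (bigD1 W) //= big1 ?addr0 => [|U nU].
  by rewrite /gcoef setU0 eqxx -setI_eq0 setI0 eqxx /= gsign0r [gone _]ffunE eqxx mul1r mulr1.
by rewrite /gcoef setU0 (negPf nU) andbF !mul0r.
Qed.

Lemma gmulDl : left_distributive (@gmul T C : galg -> galg -> galg) +%R.
Proof.
move=> a b c; apply/ffunP => W; rewrite [in RHS]ffunE !gmulE -big_split.
apply: eq_bigr => S _; rewrite -big_split; apply: eq_bigr => U _ /=.
by rewrite ffunE; ring.
Qed.

Lemma gmulDr : right_distributive (@gmul T C : galg -> galg -> galg) +%R.
Proof.
move=> a b c; apply/ffunP => W; rewrite [in RHS]ffunE !gmulE -big_split.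
apply: eq_bigr => S _; rewrite -big_split; apply: eq_bigr => U _ /=.
by rewrite ffunE; ring.
Qed.

Lemma gone_neq0 : (gone : galg) != 0.
Proof. by apply/eqP => /ffunP /(_ set0) /eqP; rewrite !ffunE eqxx oner_eq0. Qed.

HB.instance Definition _ := GRing.Zmodule_isNzRing.Build galg
  gmulA gmul1g gmulg1 gmulDl gmulDr gone_neq0.

Definition geven : {pred galg} := fun x => [forall S : {set gen}, odd #|S| ==> (x S == 0)].

Lemma gevenP (x : galg) :
  reflect (forall S, odd #|S| -> x S = 0) (x \in geven).
Proof.
apply: (iffP forallP) => H S; first by move=> oS; apply/eqP/(implyP (H S)).
by apply/implyP => oS; apply/eqP/H.
Qed.

(** Exchanging e_S and e_U costs the sign (-1)^(|S||U|), which is 1 as soon as |S| is even; y may be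
    arbitrary. *)
Lemma geven_comm (x y : galg) : x \in geven -> x * y = y * x.
Proof.
move=> /gevenP ex; apply/ffunP => W.
rewrite (gmulE x y) (gmulE y x) exchange_big; apply: eq_bigr => U _; apply: eq_bigr => S _.
have [oS|eS] := boolP (odd #|S|); first by rewrite ex // !mulr0 mul0r.
rewrite -mulrA [x S * _]mulrC mulrA; congr (_ * _ * _).
rewrite /gcoef [S :|: U]setUC disjoint_sym; case: andP => // -[dUS _].
by rewrite (gsignC dUS) -signr_odd oddM (negPf eS) andbF mul1r.
Qed.

Lemma geven_subring : subring_closed geven.
Proof.
split; first by apply/gevenP => S; rewrite ffunE; case: eqP => // ->; rewrite cards0.
  by move=> x y /gevenP ex /gevenP ey; apply/gevenP => S oS; rewrite !ffunE ex // ey // subr0.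
move=> x y /gevenP ex /gevenP ey; apply/gevenP => W oW; rewrite (gmulE x y).
rewrite big1 // => S _; rewrite big1 // => U _; rewrite /gcoef.
case: andP; last by rewrite !mul0r.
case=> dSU /eqP eW; have [oS|eS] := boolP (odd #|S|); first by rewrite ex // mulr0 mul0r.
rewrite (ey U) ?mulr0 //.
by move: oW; rewrite -eW cardsU -setI_eq0 in dSU *; rewrite (eqP dSU) cards0 subn0 oddD (negPf eS).
Qed.

HB.instance Definition _ := GRing.isSubringClosed.Build galg geven geven_subring.

(** All terms of the exponent are even, so the computation can take place in this commutative ring,
    with products over unordered sets. *)
Record evenalg := EvenAlg {even_val : galg; _ : even_val \in geven}.
HB.instance Definition _ := [isSub for even_val].
HB.instance Definition _ := [Choice of evenalg by <:].
HB.instance Definition _ := [SubChoice_isSubNzRing of evenalg by <:].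

Lemma evenalg_mulC : commutative (@GRing.mul evenalg).
Proof. by move=> x y; apply: val_inj; rewrite !rmorphM /= geven_comm ?(valP x). Qed.
HB.instance Definition _ := GRing.PzRing_hasCommutativeMul.Build evenalg evenalg_mulC.

End GrassmannRing.

(** * Delta functions built from the bilinears, and their multiplication rules *)

Section FermionBilinears.
Variables (T : finType) (R : comNzRingType) (m : T -> T -> R).
(** The relations of m_ij = psibar_i psi_j: exchanging the two psi's changes the sign, and a
    repeated psibar ([m_row]) or a repeated psi ([m_col]) gives 0. *)
Hypothesis m_anti : forall i j k l, m i j * m k l = - (m i l * m k j).
Hypothesis m_row : forall i j l, m i j * m i l = 0.
Hypothesis m_col : forall i j k, m i j * m k j = 0.
Implicit Types (A B : {set T}) (i j r s : T) (a b : R).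

Definition mtau A : R := \prod_(i in A) m i i.
(* f_A at lambda = 0. *)
Definition glue A : R := \sum_(i in A) mtau (A :\ i)
  - \sum_(i in A) \sum_(j in A | i != j) m i j * mtau (A :\ i :\ j).
(** The expansion of (psibar_s - psibar_r)(psi_s - psi_r). *)
Definition gdiff r s : R := m s s - m s r - m r s + m r r.
Definition wglue A a : R := glue A + a * mtau A.

Lemma mtauD1 A i : i \in A -> mtau A = m i i * mtau (A :\ i).
Proof. by move=> iA; rewrite /mtau (big_setD1 i). Qed.

Lemma mtauU1 A i : i \notin A -> mtau (i |: A) = m i i * mtau A.
Proof. by move=> iA; rewrite (@mtauD1 (i |: A) i) ?setU11 // setU1K. Qed.

Lemma m_mtau0l A r s : s \in A -> m r s * mtau A = 0.
Proof. by move=> sA; rewrite (mtauD1 sA) mulrA m_col mul0r. Qed.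

Lemma m_mtau0r A r s : r \in A -> m r s * mtau A = 0.
Proof. by move=> rA; rewrite (mtauD1 rA) mulrA m_row mul0r. Qed.

(** The delta function property for psi: the right side is free of r, so all psi_r with r in A act
    alike on [glue A]. Terms still containing psi_r die by [m_col]. What remains has i = r, and
    [m_anti] turns m_rj m_sr into - m_rr m_sj, whose m_rr completes [mtau (A :\ j)]. *)
Lemma glue_mr A r s : r \in A -> glue A * m s r = \sum_(i in A) m s i * mtau (A :\ i).
Proof.
move=> rA; rewrite mulrBl (bigD1 r) //= mulrDl [X in _ + X - _](_ : _ = 0) ?addr0; last first.
  by rewrite mulr_suml big1 // => i /andP[iA nir]; rewrite mulrC m_mtau0l // !inE eq_sym nir rA.
rewrite (bigD1 r) //= mulrDl [X in _ - (_ + X)](_ : _ = 0) ?addr0; last first.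
  rewrite mulr_suml big1 // => i /andP[iA nir]; rewrite mulr_suml big1 // => j /andP[jA nij].
  have [->|njr] := eqVneq j r; first by rewrite mulrAC m_col mul0r.
  by rewrite mulrC mulrCA m_mtau0l ?mulr0 // !inE eq_sym njr eq_sym nir rA.
rewrite [RHS](bigD1 r) //= [mtau _ * _]mulrC; congr (_ + _).
rewrite mulr_suml -sumrN; apply: eq_big => [j|j /andP[jA nrj]]; first by rewrite eq_sym.
rewrite mulrAC m_anti mulNr opprK.
have -> : A :\ r :\ j = A :\ j :\ r by rewrite !setDDl setUC.
by rewrite (@mtauD1 (A :\ j) r) ?inE ?rA ?nrj //; ring.
Qed.

(** The mirror image of [glue_mr], for psibar. *)
Lemma glue_ml A r s : r \in A -> glue A * m r s = \sum_(i in A) m i s * mtau (A :\ i).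
Proof.
move=> rA; rewrite mulrBl (bigD1 r) //= mulrDl [X in _ + X - _](_ : _ = 0) ?addr0; last first.
  by rewrite mulr_suml big1 // => i /andP[iA nir]; rewrite mulrC m_mtau0r // !inE eq_sym nir rA.
rewrite (exchange_big_dep (fun j => j \in A)) /=; last by move=> i j _ /andP[].
rewrite (bigD1 r) //= mulrDl [X in _ - (_ + X)](_ : _ = 0) ?addr0; last first.
  rewrite mulr_suml big1 // => j /andP[jA njr]; rewrite mulr_suml big1 // => i /andP[iA /andP[_ nij]].
  have [->|nir] := eqVneq i r; first by rewrite mulrAC m_row mul0r.
  by rewrite mulrC mulrCA m_mtau0r ?mulr0 // !inE eq_sym njr eq_sym nir rA.
rewrite [RHS](bigD1 r) //= [mtau _ * _]mulrC; congr (_ + _).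
rewrite mulr_suml -sumrN; apply: eq_big => [j|i /andP[iA /andP[_ nir]]]; first by rewrite rA.
rewrite mulrAC m_anti mulNr opprK.
by rewrite (@mtauD1 (A :\ i) r) ?inE ?rA 1?eq_sym ?nir //; ring.
Qed.

Lemma glue_mrr A r : r \in A -> glue A * m r r = mtau A.
Proof.
move=> rA; rewrite glue_mr // (bigD1 r) //= -mtauD1 // big1 ?addr0 // => i /andP[iA nir].
by rewrite m_mtau0r // !inE eq_sym nir rA.
Qed.

(** Each of the four terms of [gdiff r s] multiplies [glue A] to [mtau A], and the signs cancel. *)
Lemma glue_gdiff0 A r s : r \in A -> s \in A -> glue A * gdiff r s = 0.
Proof.
move=> rA sA; rewrite /gdiff !mulrDr !mulrN !glue_mrr //.
have -> : glue A * m s r = mtau A by rewrite (glue_mr _ rA) -(glue_mr _ sA) glue_mrr.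
have -> : glue A * m r s = mtau A by rewrite (glue_mr _ sA) -(glue_mr _ rA) glue_mrr.
by ring.
Qed.

Lemma glue_gdiffU A r s : r \in A -> s \notin A -> glue A * gdiff r s = glue (s |: A).
Proof.
move=> rA sA; rewrite /gdiff !mulrDr !mulrN (glue_mrr rA) (glue_mr _ rA) (glue_ml _ rA).
(* The terms with i = s are split off: [mtau A] matches the product with m_rr, and the sum over j
   matches the one with m_sr. Below, the terms with j = s will match m_rs, and all others carry the
   factor m_ss. *)
rewrite [RHS](_ : _ = (mtau A + \sum_(i in A) mtau ((s |: A) :\ i)) -
    (\sum_(j in s |: A | s != j) m s j * mtau ((s |: A) :\ s :\ j) +
     \sum_(i in A) \sum_(j in s |: A | i != j) m i j * mtau ((s |: A) :\ i :\ j)));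
  last by rewrite /glue big_setU1 //= setU1K // [X in _ - X]big_setU1 //= setU1K.
have E i : i \in A -> (s |: A) :\ i = s |: A :\ i.
  by move=> iA; apply/setP => x; rewrite !inE; case: eqVneq => // ->; case: eqVneq sA => // <-; rewrite iA.
under [X in _ = _ + X - _]eq_bigr => i iA.
  rewrite E // mtauU1; last by rewrite !inE (negPf sA) andbF.
  over.
rewrite -mulr_sumr.
have -> : \sum_(j in s |: A | s != j) m s j * mtau ((s |: A) :\ s :\ j)
   = \sum_(i in A) m s i * mtau (A :\ i).
  rewrite setU1K //; apply: eq_bigl => j; rewrite !inE.
  by case: eqVneq sA => [->|nsj] /=; [move/negPf-> | rewrite andbT].
have -> : \sum_(i in A) \sum_(j in s |: A | i != j) m i j * mtau ((s |: A) :\ i :\ j)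
   = \sum_(i in A) (m i s * mtau (A :\ i) + m s s * \sum_(j in A | i != j) m i j * mtau (A :\ i :\ j)).
  apply: eq_bigr => i iA; have nis : i != s by apply: contraNneq sA => <-.
  rewrite (bigD1 s) /=; last by rewrite setU11.
  rewrite E // setU1K; last by rewrite !inE (negPf sA) andbF.
  congr (_ + _); rewrite mulr_sumr; apply: eq_big => [j|j /andP[/andP[jA nij] njs]].
    rewrite !inE; case: (eqVneq j s) => [->|] /=; first by rewrite (negPf sA) andbF.
    by rewrite andbT.
  have jA' : j \in A by move: jA; rewrite !inE (negPf njs).
  have -> : (s |: A :\ i) :\ j = s |: A :\ i :\ j.
    by apply/setP => x; rewrite !inE; case: (eqVneq x s) => [->|] //=; rewrite eq_sym njs.
  rewrite mtauU1; first by ring.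
  by rewrite !inE (negPf sA) !andbF.
rewrite big_split /= -mulr_sumr /glue; ring.
Qed.

Lemma glue1 r : glue [set r] = 1.
Proof.
rewrite /glue !big_set1 setDv /mtau big_set0 big1 ?subr0 // => j /andP[].
by rewrite inE => /eqP ->; rewrite eqxx.
Qed.

Lemma glue_prod_gdiff A B r : r \in A -> [disjoint A & B] ->
  glue A * \prod_(s in B) gdiff r s = glue (A :|: B).
Proof.
move=> rA; have [n] := ubnP #|B|; elim: n => // n IHn in B *.
have [->|[s sB]] := set_0Vmem B; first by rewrite big_set0 mulr1 setU0.
rewrite (cardsD1 s) sB add1n ltnS => leB dAB.
have sA : s \notin A by rewrite (disjointFl dAB).
rewrite (big_setD1 s) //= mulrCA IHn //; last by apply: disjointWr dAB; apply: subD1set.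
rewrite mulrC glue_gdiffU; first by rewrite setUCA setD1K.
  by rewrite inE rA.
by rewrite !inE (negPf sA) eqxx.
Qed.

(** Grow A from the single vertex r, where [glue] is 1, by [glue_gdiffU]. *)
Lemma glueE A r : r \in A -> glue A = \prod_(s in A :\ r) gdiff r s.
Proof.
move=> rA; rewrite -{1}(setD1K rA) -(@glue_prod_gdiff _ _ r) ?set11 ?glue1 ?mul1r //.
by rewrite disjoints1 !inE eqxx.
Qed.

Lemma wglueE A a r : r \in A -> wglue A a = (1 + a * m r r) * glue A.
Proof. by move=> rA; rewrite /wglue -(glue_mrr rA); ring. Qed.

(** Factored around r, [glue B] contains [gdiff r s], which [glue A] annihilates. *)
Lemma glue_mul0 A B r s : r != s -> r \in A -> s \in A -> r \in B -> s \in B ->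
  glue A * glue B = 0.
Proof.
move=> nrs rA sA rB sB; rewrite (glueE rB) (big_setD1 s) ?inE 1?eq_sym ?nrs //=.
by rewrite mulrA glue_gdiff0 // mul0r.
Qed.

Lemma glue_mul A B r : A :&: B = [set r] -> glue A * glue B = glue (A :|: B).
Proof.
move=> AB; have [rA rB] : r \in A /\ r \in B.
  by apply/andP; rewrite -in_setI AB set11.
rewrite (glueE rB) glue_prod_gdiff //; last first.
  by rewrite -setI_eq0 setIDA AB setDv.
congr glue; apply/setP => x; rewrite !inE; case: (eqVneq x r) => [->|] //=.
by rewrite rA.
Qed.

Lemma wglue_mul0 A B r s a b : r != s -> r \in A -> s \in A -> r \in B -> s \in B ->
  wglue A a * wglue B b = 0.
Proof.
move=> nrs rA sA rB sB; rewrite (wglueE a rA) (wglueE b rB) mulrACA.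
by rewrite (glue_mul0 nrs) // mulr0.
Qed.

(** The weights add because m_rr has square zero: (1 + a m_rr)(1 + b m_rr) = 1 + (a + b) m_rr. *)
Lemma wglue_mul A B r a b : A :&: B = [set r] -> wglue A a * wglue B b = wglue (A :|: B) (a + b).
Proof.
move=> AB; have [rA rB] : r \in A /\ r \in B.
  by apply/andP; rewrite -in_setI AB set11.
rewrite (wglueE a rA) (wglueE b rB) (@wglueE _ _ r) ?inE ?rA // mulrACA (glue_mul AB).
by congr (_ * _); rewrite mulrDl mul1r mulrDr mulr1 mulrACA m_row mulr0 addr0; ring.
Qed.

Lemma wglue1 r a : wglue [set r] a = 1 + a * m r r.
Proof. by rewrite (@wglueE _ _ r) ?set11 // glue1 mulr1. Qed.

Lemma wglue_merge A a (P : {set {set T}}) (nu : {set T} -> R) :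
  trivIset P -> (forall C, C \in P -> exists r, A :&: C = [set r]) ->
  wglue A a * \prod_(C in P) wglue C (nu C) = wglue (A :|: cover P) (a + \sum_(C in P) nu C).
Proof.
have [n] := ubnP #|P|; elim: n => // n IHn in P *.
have [->|[C CP]] := set_0Vmem P.
  by rewrite !big_set0 /cover big_set0 mulr1 setU0 addr0.
rewrite (cardsD1 C) CP add1n ltnS => leP tP AP.
have [r ACr] := AP C CP.
have sP : P :\ C \subset P by apply: subD1set.
rewrite (big_setD1 C) //= mulrCA IHn //; last by move=> D; rewrite inE => /andP[_ /AP].
  rewrite mulrC (@wglue_mul _ _ r).
    rewrite [X in _ = wglue _ (_ + X)](big_setD1 C) //= /cover (big_setD1 C CP) /= -setUA.
    by rewrite [X in _ :|: X]setUC; congr (wglue _ _); ring.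
  (* The pieces attached so far are disjoint from C, so C still meets the union in r alone. *)
  rewrite setIUl ACr; apply/setUidPl.
  rewrite (_ : _ :&: C = set0) ?sub0set //.
  apply/setP => x; rewrite !inE; apply/negP => /andP[/bigcupP[D]].
  rewrite in_setD1 => /andP[nDC DP] xD xC.
  by move/trivIsetP: tP => /(_ D C DP CP nDC) /disjointFr /(_ xD); rewrite xC.
exact: trivIsetS tP.
Qed.

End FermionBilinears.

(** * Connectivity, cycles and components when one hyperedge is inserted *)

Section AddHyperedge.
Variable T : finType.
Implicit Types (F : {set {set T}}) (A B : {set T}) (x y : T).

Definition hcomp F x : {set T} := [set y | connect (hadj F) x y].

Lemma hadj_sym F : symmetric (hadj F).
Proof.
by move=> x y; apply/existsP/existsP => -[A /and3P[AF xA yA]]; exists A; apply/and3P.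
Qed.

Lemma connect_hadj_sym F : connect_sym (hadj F).
Proof. exact: sym_connect_sym (@hadj_sym F). Qed.

Lemma hadjP F x y :
  reflect (exists A, [/\ A \in F, x \in A & y \in A]) (hadj F x y).
Proof.
by apply: (iffP existsP) => -[A]; [move=> /and3P[]|case]; exists A => //; apply/and3P.
Qed.

Lemma connect_hadj_sub F F' x y : F \subset F' ->
  connect (hadj F) x y -> connect (hadj F') x y.
Proof.
move=> sF; apply: connect_sub => u v /hadjP[A [AF uA vA]].
by apply/connect1/hadjP; exists A; rewrite (subsetP sF).
Qed.

Lemma connect_hadjU1 F A x y :
  reflect (connect (hadj F) x y \/
    exists a b, [/\ a \in A, b \in A, connect (hadj F) x a & connect (hadj F) b y])
  (connect (hadj (A |: F)) x y).
Proof.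
have sF : F \subset A |: F by apply: subsetUr.
apply: (iffP idP) => [|[|[a [b [aA bA xa yb]]]]]; last 2 first.
- exact: connect_hadj_sub.
- apply: connect_trans (connect_hadj_sub sF xa) _.
  apply: connect_trans (connect_hadj_sub sF yb).
  by apply/connect1/hadjP; exists A; rewrite setU11.
case/connectP => p; elim: p x => [|z p IHp] x /=; first by move=> _ ->; left.
case/andP => /hadjP[B [BF xB zB]] zp yE; have {zp yE IHp} := IHp _ zp yE.
move: BF; rewrite in_setU1 => /predU1P[eBA|BF].
  rewrite eBA in xB zB; case=> [zy|[a [b [_ bA _ yb]]]]; right.
    by exists x, z.
  by exists x, b.
have xz : connect (hadj F) x z by apply/connect1/hadjP; exists B.
case=> [zy|[a [b [aA bA za yb]]]]; first by left; apply: connect_trans zy.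
by right; exists a, b; split=> //; apply: connect_trans za.
Qed.

Lemma hyperforest_sub F F' : F \subset F' -> hyperforest F' -> hyperforest F.
Proof.
move=> /subsetP sF fF k v e [k2 vI eI H]; apply: (fF k v e); split=> // i.
by have [/sF ? ? ?] := H i.
Qed.

(** Total functions on [nat] make cutting a walk a mere shift of indices; only the values up to k
    matter. *)
Definition hwalk F x y k := exists (v : nat -> T) (e : nat -> {set T}),
  [/\ v 0%N = x, v k = y &
      forall i, (i < k)%N -> [/\ e i \in F, v i \in e i & v i.+1 \in e i]].

Lemma connect_hwalk F x y : connect (hadj F) x y -> exists k, hwalk F x y k.
Proof.
case/connectP => p; elim: p x => [|z p IHp] x /=.
  by move=> _ ->; exists 0%N, (fun=> x), (fun=> set0).
case/andP => /hadjP[B [BF xB zB]] zp yE.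
have [k [v [e [v0 vk ve]]]] := IHp _ zp yE.
exists k.+1, (fun n => if n is n'.+1 then v n' else x), (fun n => if n is n'.+1 then e n' else B).
by split=> // -[_|i]; [rewrite v0 | apply: ve].
Qed.

(** A shortest walk repeats no vertex and no hyperedge, since a repetition would allow a
    shortcut. *)
Lemma hwalk_min F x y : connect (hadj F) x y -> exists k v e,
  [/\ v 0%N = x, v k = y,
      forall i, (i < k)%N -> [/\ e i \in F, v i \in e i & v i.+1 \in e i],
      forall i j, (i < j <= k)%N -> v i <> v j &
      forall i j, (i < j < k)%N -> e i <> e j].
Proof.
move=> /connect_hwalk Hk.
have {}Hk : exists k, `[< hwalk F x y k >] by case: Hk => k ?; exists k; apply/asboolP.
case: (ex_minnP Hk) => k /asboolP[v [e [v0 vk ve]]] kmin.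
exists k, v, e; split=> // i j /andP[ij jk] eij.
- have : hwalk F x y (k - (j - i)).
    (* If v i = v j, the closed piece between the two visits is cut out. *)
    exists (fun n => if (n <= i)%N then v n else v (n + (j - i))%N).
    exists (fun n => if (n < i)%N then e n else e (n + (j - i))%N).
    split; rewrite ?leq0n //.
      case: leqP => [|_]; last by rewrite -vk; congr v; lia.
      move=> kle; have -> : (k - (j - i) = i)%N by lia.
      by rewrite eij -vk; congr v; lia.
    move=> n nk; have [ni|ni|ni] := ltngtP n i; last rewrite ni.
    + by apply: ve; lia.
    + by rewrite addSn; apply: ve; lia.
    + rewrite eij addSn; have -> : (i + (j - i) = j)%N by lia.
      by apply: ve; lia.
  by move/asboolP/kmin; lia.
- have : hwalk F x y (k - (j - i)).
    (* If e i = e j, this hyperedge leads directly from v i to v (j + 1). *)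
    exists (fun n => if (n <= i)%N then v n else v (n + (j - i))%N).
    exists (fun n => if (n <= i)%N then e n else e (n + (j - i))%N).
    split; rewrite ?leq0n //.
      by case: leqP => [?|_]; [exfalso; lia|rewrite -vk; congr v; lia].
    move=> n nk; have [ni|ni|ni] := ltngtP n i; last rewrite ni.
    + by apply: ve; lia.
    + by rewrite addSn; apply: ve; lia.
    + rewrite addSn; have -> : (i + (j - i) = j)%N by lia.
      have [? ? _] := ve i ltac:(lia); have [_ _] := ve j ltac:(lia).
      by rewrite -eij.
  by move/asboolP/kmin; lia.
Qed.

Lemma val_iter_ordS k (i : 'I_k) n : iter n (@ordS k) i = ((i + n) %% k)%N :> nat.
Proof.
elim: n => [|n IHn] /=; first by rewrite addn0 modn_small.
by rewrite IHn -addn1 modnDml addn1 addnS.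
Qed.

(** A walk in F between two distinct vertices of A closes up through A to a cycle. Conversely, a
    cycle through A leaves, once A is removed, a walk in F between two distinct vertices of A. *)
Lemma hyperforestU1 F A : A \notin F ->
  hyperforest (A |: F) <->
  hyperforest F /\ forall x y, x \in A -> y \in A -> connect (hadj F) x y -> x = y.
Proof.
move=> AF; split=> [fAF|[fF cA] k v e [k2 vI eI ve]].
  split=> [|x y xA yA]; first exact: hyperforest_sub (subsetUr _ _) fAF.
  case/hwalk_min => k [v [e [v0 vk ve vI eI]]]; apply/eqP/negP => /negP nxy.
  have k0 : (0 < k)%N by case: k vk {ve vI eI} => // vk; rewrite -v0 -vk eqxx in nxy.
  have eA i j : (i < j <= k)%N -> (if i < k then e i else A)%N <> (if j < k then e j else A)%N.
    move=> /andP[ij jk]; rewrite (leq_trans ij jk).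
    case: ltnP => jk'; first by apply: eI; rewrite ij.
    by have [eF _ _] := ve i (leq_trans ij jk) => eiA; rewrite -eiA eF in AF.
  (* The walk has k + 1 vertices; the last index k receives A, which leads from v k = y back to v 0
     = x. *)
  apply: (fAF k.+1 (fun i => v i) (fun i => if (i < k)%N then e i else A)); split=> //.
  - move=> i j /= eij; apply/val_inj; case: (ltngtP i j) => // ij.
      by case: (vI i j); rewrite ?ij //= -ltnS ltn_ord.
    by case: (vI j i); rewrite ?ij //= -ltnS ltn_ord.
  - move=> i j /= eij; apply/val_inj; case: (ltngtP i j) => // ij.
      by case: (eA i j); rewrite ?ij //= -ltnS ltn_ord.
    by case: (eA j i); rewrite ?ij //= -ltnS ltn_ord.
  - move=> i /=; case: ltnP => ik.
      by rewrite modn_small //; have [eF ? ?] := ve i ik; rewrite in_setU1 eF orbT.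
    have -> : i = k :> nat by apply/eqP; rewrite eqn_leq ik -ltnS ltn_ord.
    by rewrite modnn v0 vk setU11.
have [/existsP[i0 /eqP ei0]|/existsPn nA] := boolP [exists i, e i == A]; last first.
  apply: (fF k v e); split=> // i; have [eF ? ?] := ve i; split=> //.
  by move: eF; rewrite in_setU1 (negPf (nA i)).
(* By injectivity of e only the index i0 carries A, so fewer than k steps from [ordS i0] stay within
   F; k - 1 of them reach i0. *)
have step n : (n < k)%N -> connect (hadj F) (v (ordS i0)) (v (iter n (@ordS k) (ordS i0))).
  elim: n => [|n IHn] nk //=; apply: connect_trans (IHn (ltnW nk)) _.
  rewrite -!iterSr /=; set i := ordS (iter n _ _).
  have [eF vi vS] := ve i; apply/connect1/hadjP; exists (e i); split=> //.
  move: eF; rewrite in_setU1 -ei0 (inj_eq eI) => /predU1P[] // /(congr1 (@nat_of_ord k)).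
  rewrite /i -iterS val_iter_ordS => /eqP; rewrite -[X in _ == X](modn_small (ltn_ord i0)).
  by rewrite -[X in _ == X %[mod _]]addn0 eqn_modDl mod0n modn_small.
have vi0 : v i0 \in A by have [_ + _] := ve i0; rewrite ei0.
have vS : v (ordS i0) \in A by have [_ _] := ve i0; rewrite ei0.
have k0 : (0 < k)%N by apply: leq_trans k2.
have := step k.-1; rewrite ltn_predL => /(_ k0).
have -> : iter k.-1 (@ordS k) (ordS i0) = i0.
  apply: val_inj; rewrite /= -iterSr prednK //.
  by rewrite val_iter_ordS modnDr modn_small.
(* The two vertices coincide, so i0 + 1 = i0 modulo k, which k >= 2 excludes. *)
move=> /(cA _ _ vS vi0) /vI /(congr1 (@nat_of_ord k)) /= /eqP.
rewrite -[X in _ == X](modn_small (ltn_ord i0)) -addn1 -[X in _ == X %[mod _]]addn0.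
by rewrite eqn_modDl mod0n modn_small.
Qed.

Lemma mem_hcomp F x : x \in hcomp F x. Proof. by rewrite inE connect0. Qed.

Lemma hcomp_eq F x y : y \in hcomp F x -> hcomp F x = hcomp F y.
Proof.
rewrite inE => xy; apply/setP => z; rewrite !inE.
exact: (same_connect (@connect_hadj_sym F) xy).
Qed.

Lemma hcomp_in F x : hcomp F x \in components F.
Proof. by apply/imsetP; exists x. Qed.

Lemma componentsP F (C : {set T}) :
  reflect (exists x, C = hcomp F x) (C \in components F).
Proof. by apply: (iffP imsetP) => [[x _ ->]|[x ->]]; exists x. Qed.

Lemma component_eq F (C : {set T}) x : C \in components F -> x \in C -> C = hcomp F x.
Proof. by move=> /componentsP[y ->]; apply: hcomp_eq. Qed.

Lemma trivIset_components F : trivIset (components F).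
Proof.
apply/trivIsetP => C D CF DF; apply: contraR => /pred0Pn[x /andP[/= xC xD]].
by rewrite (component_eq CF xC) (component_eq DF xD).
Qed.

Lemma sub_hcomp F A x : A \in F -> x \in A -> A \subset hcomp F x.
Proof.
by move=> AF xA; apply/subsetP => y yA; rewrite inE; apply/connect1/hadjP; exists A.
Qed.

Definition touched F A := [set C in components F | ~~ [disjoint A & C]].
Definition untouched F A := [set C in components F | [disjoint A & C]].

Lemma mem_cover_touched F A y :
  reflect (exists2 a, a \in A & connect (hadj F) a y) (y \in cover (touched F A)).
Proof.
apply: (iffP bigcupP) => [[C]|[a aA ay]].
  rewrite inE => /andP[CF /pred0Pn[a /andP[/= aA aC]]] yC; exists a => //.
  by move: yC; rewrite (component_eq CF aC) inE.
exists (hcomp F a); last by rewrite inE.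
by rewrite inE hcomp_in; apply/pred0Pn; exists a; rewrite /= aA mem_hcomp.
Qed.

Lemma sub_cover_touched F A : A \subset cover (touched F A).
Proof. by apply/subsetP => a aA; apply/mem_cover_touched; exists a. Qed.

(** By [connect_hadjU1], a vertex connected to A now reaches everything connected to A, and any
    other vertex keeps its component. For empty A the merged set would be empty, hence no
    component. *)
Lemma componentsU1 F A : A != set0 ->
  components (A |: F) = cover (touched F A) |: untouched F A.
Proof.
case/set0Pn => a0 a0A.
have touch x : (exists2 a, a \in A & connect (hadj F) x a) ->
    hcomp (A |: F) x = cover (touched F A).
  case=> a aA xa; apply/setP => y; rewrite inE.
  apply/connect_hadjU1/mem_cover_touched => [[xy|[b [c [bA cA _ cy]]]]|[b bA yb]].
  - by exists a => //; rewrite connect_hadj_sym in xa; apply: connect_trans xy.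
  - by exists c.
  - by right; exists a, b.
have untouch x : [disjoint A & hcomp F x] -> hcomp (A |: F) x = hcomp F x.
  move=> dA; apply/setP => y; rewrite !inE.
  apply/connect_hadjU1/idP => [[//|[b [c [bA _ xb _]]]]|]; last by left.
  by have := disjointFr dA bA; rewrite inE xb.
apply/setP => C; rewrite in_setU1 inE; apply/componentsP/idP => [[x ->]|].
  have [dA|/pred0Pn[a /andP[/= aA]]] := boolP [disjoint A & hcomp F x].
    by rewrite untouch // hcomp_in dA orbT.
  by rewrite inE => xa; rewrite touch ?eqxx //; exists a.
case/predU1P => [->|/andP[/componentsP[x ->] dA]]; last by exists x; rewrite untouch.
by exists a0; rewrite touch //; exists a0.
Qed.

Lemma cover_touched_notin F A : A != set0 -> cover (touched F A) \notin untouched F A.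
Proof.
case/set0Pn => a aA; rewrite inE negb_and orbC; apply/orP; left.
by apply/pred0Pn; exists a; rewrite /= aA (subsetP (sub_cover_touched F A)).
Qed.

Lemma trivIset_touched F A : trivIset (touched F A).
Proof. by apply: trivIsetS (trivIset_components F); apply/subsetP => C; rewrite inE => /andP[]. Qed.

(** Supplies the intersection hypothesis of [wglue_merge] from the acyclicity criterion of
    [hyperforestU1]. *)
Lemma touched_setI1 F A C :
  (forall x y, x \in A -> y \in A -> connect (hadj F) x y -> x = y) ->
  C \in touched F A -> exists r, A :&: C = [set r].
Proof.
move=> cA; rewrite inE => /andP[CF /pred0Pn[a /andP[/= aA aC]]]; exists a.
apply/setP => y; rewrite !inE; apply/andP/eqP => [[yA yC]|->] //.
by apply/esym/cA => //; move: yC; rewrite (component_eq CF aC) inE.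
Qed.

Lemma card_touched F A :
  (forall x y, x \in A -> y \in A -> connect (hadj F) x y -> x = y) ->
  #|touched F A| = #|A|.
Proof.
move=> cA; have -> : touched F A = [set hcomp F a | a in A].
  apply/setP => C; rewrite inE; apply/andP/imsetP => [[CF]|[a aA ->]].
    by case/pred0Pn=> a /andP[/= aA aC]; exists a; rewrite // (component_eq CF aC).
  by rewrite hcomp_in; split=> //; apply/pred0Pn; exists a; rewrite /= aA mem_hcomp.
apply: card_in_imset => a b aA bA eab; apply: cA => //.
by have := mem_hcomp F b; rewrite -eab inE.
Qed.

Section EdgeSums.
Variables (V : nmodType) (c : {set T} -> V).

(** Every B in F is nonempty, so it lies in exactly one component, that of any of its vertices. The
    values are in an [nmodType] to serve both the weights in a ring and the vertex count in
    [nat]. *)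
Lemma edge_sum_cover_touched F A : is_hypergraph F -> A \notin F ->
  \sum_(B in A |: F | B \subset cover (touched F A)) c B =
  c A + \sum_(C in touched F A) \sum_(B in F | B \subset C) c B.
Proof.
move=> hF AF; rewrite big_mkcondr big_setU1 //= sub_cover_touched; congr (_ + _).
rewrite (exchange_big_dep (fun B => B \in F)) /=; last by move=> C B _ /andP[].
apply: eq_bigr => B BF.
have [b bB] : exists b, b \in B by apply/set0Pn; rewrite -card_gt0 (ltn_trans _ (hF B BF)).
have CE C : C \in touched F A -> B \subset C -> C = hcomp F b.
  by rewrite inE => /andP[CF _] /subsetP/(_ b bB); apply: component_eq.
have BE : (B \subset cover (touched F A)) = (hcomp F b \in touched F A).
  apply/idP/idP => [/subsetP/(_ b bB)/bigcupP[C CF bC]|bF].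
    by rewrite -(component_eq _ bC) //; move: CF; rewrite inE => /andP[].
  by apply: subset_trans (sub_hcomp BF bB) _; apply: bigcup_sup bF.
rewrite BE; case: ifP => bF.
  rewrite (big_pred1 (hcomp F b)) // => C /=; rewrite BF /=.
  by apply/andP/eqP => [[]|->]; [apply: CE | rewrite bF sub_hcomp].
rewrite big_pred0 // => C; rewrite BF /=; apply/negP => /andP[CF BC].
by rewrite -(CE C CF BC) CF in bF.
Qed.

Lemma edge_sum_untouched F A C : A != set0 -> A \notin F -> C \in untouched F A ->
  \sum_(B in A |: F | B \subset C) c B = \sum_(B in F | B \subset C) c B.
Proof.
case/set0Pn => a aA AF; rewrite inE => /andP[_ dA].
rewrite big_mkcondr big_setU1 //= -big_mkcondr.
case: ifP => [/subsetP/(_ a aA)|_]; last by rewrite add0r.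
by rewrite (disjointFr dA aA).
Qed.

End EdgeSums.

Lemma is_hypergraphU1 F A : is_hypergraph (A |: F) -> A != set0 /\ is_hypergraph F.
Proof.
move=> h; split; first by rewrite -card_gt0 (ltn_trans _ (h A _)) ?setU11.
by move=> B BF; apply: h; rewrite in_setU1 BF orbT.
Qed.

Lemma hyperedge_ind (P : {set {set T}} -> Prop) :
  P set0 ->
  (forall A F, A != set0 -> is_hypergraph F -> A \notin F -> P F -> P (A |: F)) ->
  forall F, is_hypergraph F -> P F.
Proof.
move=> P0 PU F; have [n] := ubnP #|F|; elim: n => // n IHn in F *.
have [->|[A AF]] := set_0Vmem F; first by [].
rewrite (cardsD1 A) AF ltnS -{2 3}(setD1K AF) => leF hF.
have [A0 hF'] := is_hypergraphU1 hF.
by apply: PU => //; [rewrite setD11 | apply: IHn].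
Qed.

Lemma components0 : components (set0 : {set {set T}}) = [set [set x] | x : T].
Proof.
apply: eq_imset => x; apply/setP => y; rewrite !inE eq_sym.
apply/idP/eqP => [/connectP[[|z p] //= /andP[/hadjP[A []]]]|->]; last exact: connect0.
by rewrite inE.
Qed.

Lemma hyperforest0 : hyperforest (set0 : {set {set T}}).
Proof.
move=> k v e [k2 _ _ /(_ (Ordinal (ltnW k2)))[]].
by rewrite inE.
Qed.

(** The hypertree analogue of counting one more vertex than edges. Inserting A merges #|A|
    components, whose surplus ones add up to #|A| = #|A|.-1 + 1. *)
Lemma card_component F C : is_hypergraph F -> hyperforest F -> C \in components F ->
  #|C| = (\sum_(B in F | B \subset C) #|B|.-1).+1.
Proof.
move=> hF; move: C; elim/hyperedge_ind: F / hF => [C _|A F A0 hF AF IHF C].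
  rewrite components0 => /imsetP[x _ ->].
  by rewrite cards1 big_pred0 // => B; rewrite inE.
case/(hyperforestU1 AF) => /IHF {}IHF cA.
rewrite componentsU1 // => /setU1P[->|CU]; last first.
  by rewrite edge_sum_untouched // IHF //; move: CU; rewrite inE => /andP[].
rewrite edge_sum_cover_touched // -(eqP (trivIset_touched F A)).
have -> : \sum_(C in touched F A) #|C| =
    (\sum_(C in touched F A) \sum_(B in F | B \subset C) #|B|.-1 + #|touched F A|)%N.
  rewrite -sum1_card -big_split /=; apply: eq_bigr => D; rewrite inE => /andP[/IHF -> _].
  by rewrite addn1.
by rewrite card_touched // addrC -addnS prednK ?card_gt0.
Qed.

End AddHyperedge.

(** * The product over a set of hyperedges collapses to a product over components *)

Section ForestProduct.
Variables (T : finType) (R : comNzRingType) (m : T -> T -> R).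
Hypothesis m_anti : forall i j k l, m i j * m k l = - (m i l * m k j).
Hypothesis m_row : forall i j l, m i j * m i l = 0.
Hypothesis m_col : forall i j k, m i j * m k j = 0.

Lemma wglue_prod (c : {set T} -> R) (t : T -> R) (F : {set {set T}}) :
  is_hypergraph F ->
  \prod_i (1 + t i * m i i) * \prod_(A in F) wglue m A (c A) =
  if `[< hyperforest F >]
  then \prod_(C in components F) wglue m C (\sum_(i in C) t i + \sum_(B in F | B \subset C) c B)
  else 0.
Proof.
move=> hF; elim/hyperedge_ind: F / hF => [|A F A0 hF AF IHF].
  rewrite asboolT; last exact: hyperforest0.
  rewrite big_set0 mulr1 components0 big_imset /=; last by move=> x y _ _; apply: set1_inj.
  apply: eq_bigr => i _; rewrite big_set1 big_pred0 ?addr0 => [|B]; last by rewrite inE.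
  by rewrite (wglue1 m_anti m_row m_col).
rewrite big_setU1 //= mulrCA IHF {IHF}.
case: asboolP => [fF|nF]; last first.
  by rewrite mulr0; case: asboolP => // /(hyperforestU1 AF)[].
case: asboolP => [/(hyperforestU1 AF)[_ cA]|nAF]; last first.
  (* When A closes a cycle, some component of F shares two vertices with A, and its factor is
     annihilated by that of A. *)
  have [x [y [xA yA xy nxy]]] : exists x y, [/\ x \in A, y \in A, connect (hadj F) x y & x <> y].
    apply: contrapT => H; apply: nAF; apply/(hyperforestU1 AF); split=> // x y xA yA xy.
    by apply: contrapT => nxy; apply: H; exists x, y.
  rewrite (bigD1 (hcomp F x)) ?hcomp_in //= mulrA.
  rewrite (wglue_mul0 m_anti m_row m_col (r := x) (s := y)) ?mul0r ?mem_hcomp //; first exact/eqP.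
  by rewrite inE.
(* The factors of the components met by A are absorbed into that of A; the others are unchanged. *)
rewrite (bigID [in touched F A]) /= mulrA.
rewrite (eq_bigl [in touched F A]); last first.
  by move=> C /=; rewrite andbC andb_idr // inE => /andP[].
rewrite (wglue_merge m_anti m_row m_col) ?trivIset_touched //; last first.
  by move=> C; apply: touched_setI1.
rewrite (setUidPr (sub_cover_touched F A)) componentsU1 // big_setU1 ?cover_touched_notin //=.
congr (_ * _).
  rewrite edge_sum_cover_touched // big_split /= big_trivIset ?trivIset_touched //.
  by congr (wglue _ _ _); ring.
apply: eq_big => [C|C /andP[CF]]; first by rewrite !inE; case: (C \in _); rewrite //= negbK.
rewrite inE CF /= negbK => dA; rewrite edge_sum_untouched //.
by rewrite inE CF.
Qed.

End ForestProduct.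

(** * The truncated exponential on elements of square zero *)

Section TruncatedExponential.
Variables (K : fieldType) (R : comNzRingType) (phi : {rmorphism K -> R}) (N : nat).
Hypothesis fact_neq0 : forall k, (k`!%:R : K) != 0.

Definition texp (x : R) : R := \sum_(k < N.+1) phi (k`!%:R^-1) * x ^+ k.

Lemma exprD_sq0 (x y : R) k : y ^+ 2 = 0 -> (x + y) ^+ k.+1 = x ^+ k.+1 + k.+1%:R * x ^+ k * y.
Proof.
move=> y0; elim: k => [|k IHk]; first by rewrite !expr1 expr0 !mul1r.
rewrite exprS {}IHk.
have -> : (x + y) * (x ^+ k.+1 + k.+1%:R * x ^+ k * y)
  = x ^+ k.+2 + k.+2%:R * x ^+ k.+1 * y + k.+1%:R * x ^+ k * y ^+ 2.
  by rewrite [k.+2%:R]mulrSr !exprS expr0; ring.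
by rewrite y0; ring.
Qed.

(** With y of square zero the binomial expansion stops at first order. The hypothesis on x ^+ N * y
    removes the term of degree N + 1 on the right, which has no counterpart in the truncated left
    side. *)
Lemma texpD (x y : R) : y ^+ 2 = 0 -> x ^+ N * y = 0 -> texp (x + y) = texp x * (1 + y).
Proof.
move=> y0 xN; rewrite mulrDr mulr1 {1}/texp big_ord_recl /=.
rewrite /texp [in X in X * y]big_ord_recr /= mulrDl -[phi _ * _ * y]mulrA xN mulr0 addr0.
rewrite big_ord_recl /= -addrA; congr (_ + _); rewrite mulr_suml -big_split /=.
apply: eq_bigr => i _; rewrite /bump add1n exprD_sq0 // mulrDr; congr (_ + _).
have -> : phi (i`!%:R^-1) = phi (i.+1`!%:R^-1) * i.+1%:R.
  rewrite -(rmorph_nat phi) -rmorphM factS natrM invfM mulrAC mulVf ?mul1r //.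
  by have := fact_neq0 i.+1; rewrite factS natrM mulf_eq0 negb_or => /andP[].
by ring.
Qed.

Lemma texp0 : texp 0 = 1.
Proof.
rewrite /texp big_ord_recl /= fact0 invr1 rmorph1 mul1r expr0 big1 ?addr0 // => i _.
by rewrite expr0n mulr0.
Qed.

End TruncatedExponential.

(** * Degrees, the Berezin integral and the expansion over hyperforests *)

Section GrassmannHyperforests.
Variables (T : finType) (K : fieldType).
Local Notation gen := (bool * T)%type.
Local Notation galg := (galg T K).
Local Notation evenalg := (evenalg T K).
Implicit Types (S U W : {set gen}) (x y : galg) (A : {set T}).

Definition mono S : galg := [ffun W => (W == S)%:R].

Lemma mono_mulE S U W : (mono S * mono U) W = gcoef K S U W.
Proof.
rewrite (gmulE (mono S)) (bigD1 S) //= [X in _ + X]big1 ?addr0; last first.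
  by move=> P nP; rewrite big1 // => Q _; rewrite ffunE (negPf nP) mulr0 mul0r.
rewrite (bigD1 U) //= big1 ?addr0; last by move=> Q nQ; rewrite [mono U Q]ffunE (negPf nQ) mulr0.
by rewrite !ffunE !eqxx !mulr1.
Qed.

Lemma gcoef_disj S U : [disjoint S & U] -> forall W, gcoef K S U W = gsign K S U * mono (S :|: U) W.
Proof.
by move=> dSU W; rewrite /gcoef dSU ffunE eq_sym; case: eqP => _; rewrite ?mulr1 ?mulr0.
Qed.

Definition gvar (g : gen) : galg := mono [set g].

Lemma gvar_sq g : gvar g * gvar g = 0.
Proof.
apply/ffunP => W; rewrite mono_mulE [RHS]ffunE /gcoef.
by rewrite disjoints1 inE eqxx.
Qed.

Lemma gvar_anti g h : gvar g * gvar h = - (gvar h * gvar g).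
Proof.
apply/ffunP => W; rewrite [RHS]ffunE !mono_mulE /gcoef disjoint_sym setUC.
case: andP => [[dgh _]|_]; last by rewrite oppr0.
by rewrite (gsignC K dgh) !cards1 muln1 expr1 mulN1r.
Qed.

Lemma gvar_homog g W : #|W| != 1%N -> gvar g W = 0.
Proof. by rewrite ffunE; case: (W =P _) => // ->; rewrite cards1. Qed.

Lemma bilinear_even i j : gvar (false, i) * gvar (true, j) \in @geven T K.
Proof.
apply/gevenP => W oW; rewrite mono_mulE /gcoef; case: andP => // -[dij /eqP eW].
move: oW; rewrite -eW cardsU -setI_eq0 in dij *.
by rewrite (eqP dij) cards0 !cards1.
Qed.

Definition bilinear i j : evenalg := EvenAlg (bilinear_even i j).

Lemma bilinear_anti i j k l : bilinear i j * bilinear k l = - (bilinear i l * bilinear k j).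
Proof.
apply: val_inj; rewrite rmorphN !rmorphM /=.
rewrite -!mulrA -mulrN; congr (_ * _).
rewrite !mulrA (gvar_anti _ (false, k)) (gvar_anti (true, l) (false, k)).
by rewrite !mulNr -!mulrA [in LHS]gvar_anti mulrN.
Qed.

Lemma bilinear_row i j l : bilinear i j * bilinear i l = 0.
Proof.
apply: val_inj; rewrite rmorphM /= -mulrA [gvar (true, j) * _]mulrA gvar_anti.
by rewrite !mulNr mulrN !mulrA gvar_sq !mul0r oppr0.
Qed.

Lemma bilinear_col i j k : bilinear i j * bilinear k j = 0.
Proof.
apply: val_inj; rewrite rmorphM /= mulrA -[gvar (false, i) * _ * _]mulrA.
by rewrite (gvar_anti (true, j)) mulrN mulNr -!mulrA gvar_sq !mulr0 oppr0.
Qed.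

Definition gconst (c : K) : galg := gscale c (gone T K).

Lemma gconst_even c : gconst c \in @geven T K.
Proof. by apply/gevenP => W oW; rewrite !ffunE; case: eqP oW => [->|]; rewrite ?cards0 ?mulr0. Qed.

Lemma gscale_mul c x : gscale c x = gconst c * x.
Proof.
apply/ffunP => W; rewrite (gmulE (gconst c)) ffunE -[x in LHS]mul1r (gmulE (gone T K)) mulr_sumr.
apply: eq_bigr => S _; rewrite mulr_sumr; apply: eq_bigr => U _.
by rewrite [gconst c S]ffunE; ring.
Qed.

Definition econst (c : K) : evenalg := EvenAlg (gconst_even c).

Lemma econst_zmod : zmod_morphism econst.
Proof. by move=> a b; apply: val_inj; rewrite rmorphB /=; apply/ffunP => W; rewrite !ffunE mulrBl. Qed.
HB.instance Definition _ := GRing.isZmodMorphism.Build K evenalg econst econst_zmod.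

Lemma econst_monoid : monoid_morphism econst.
Proof.
split=> [|a b]; apply: val_inj; first by apply/ffunP => W; rewrite !ffunE mul1r.
by rewrite rmorphM /= -gscale_mul; apply/ffunP => W; rewrite !ffunE mulrA.
Qed.
HB.instance Definition _ := GRing.isMonoidMorphism.Build K evenalg econst econst_monoid.

(** Two bounds on degree: [lowdeg] bounds it from below and yields nilpotency, [deglt] bounds it
    strictly from above and isolates top coefficients. *)
Definition lowdeg d x := forall W, (#|W| < d)%N -> x W = 0.
Definition deglt d x := forall W, (d <= #|W|)%N -> x W = 0.

Lemma lowdegM a b x y : lowdeg a x -> lowdeg b y -> lowdeg (a + b) (x * y).
Proof.
move=> xa yb W leW; rewrite (gmulE x y) big1 // => S _; rewrite big1 // => U _.
rewrite /gcoef; case: andP => [[dSU /eqP eW]|_]; last by rewrite !mul0r.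
have [/xa ->|aS] := ltnP #|S| a; first by rewrite mulr0 mul0r.
rewrite yb ?mulr0 //; move: leW; rewrite -eW cardsU -setI_eq0 in dSU *.
by rewrite (eqP dSU) cards0; lia.
Qed.

Lemma degltM a b x y : deglt a x -> deglt b.+1 y -> deglt (a + b) (x * y).
Proof.
move=> xa yb W leW; rewrite (gmulE x y) big1 // => S _; rewrite big1 // => U _.
rewrite /gcoef; case: andP => [[dSU /eqP eW]|_]; last by rewrite !mul0r.
have [aS|/xa ->] := ltnP #|S| a; last by rewrite mulr0 mul0r.
rewrite yb ?mulr0 //; move: leW; rewrite -eW cardsU -setI_eq0 in dSU *.
by rewrite (eqP dSU) cards0; lia.
Qed.

Lemma lowdegD d x y : lowdeg d x -> lowdeg d y -> lowdeg d (x + y).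
Proof. by move=> xd yd W Wd; rewrite ffunE xd // yd // addr0. Qed.

Lemma degltD d x y : deglt d x -> deglt d y -> deglt d (x + y).
Proof. by move=> xd yd W Wd; rewrite ffunE xd // yd // addr0. Qed.

Lemma degltN d x : deglt d x -> deglt d (- x).
Proof. by move=> xd W Wd; rewrite ffunE xd // oppr0. Qed.

Lemma lowdegN d x : lowdeg d x -> lowdeg d (- x).
Proof. by move=> xd W Wd; rewrite ffunE xd // oppr0. Qed.

Lemma lowdegX x n : lowdeg 1 x -> lowdeg n (x ^+ n).
Proof.
move=> x1; elim: n => [|n IHn] //; rewrite exprS -add1n; exact: lowdegM.
Qed.

Lemma lowdeg_sub a b x : (a <= b)%N -> lowdeg b x -> lowdeg a x.
Proof. by move=> ab xb W Wa; apply: xb; apply: leq_trans ab. Qed.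

Lemma deglt_sub a b x : (a <= b)%N -> deglt a x -> deglt b x.
Proof. by move=> ab xb W Wa; apply: xb; apply: leq_trans Wa. Qed.

Lemma lowdeg_eq0 x : lowdeg #|{: gen}|.+1 x -> x = 0.
Proof. by move=> xd; apply/ffunP => W; rewrite xd ?ffunE // ltnS max_card. Qed.

Lemma lowdeg_bilinear i j : lowdeg 2 (val (bilinear i j)).
Proof. by apply: (@lowdegM 1 1) => W W1; rewrite gvar_homog // neq_ltn W1. Qed.

Lemma deglt_bilinear i j : deglt 3 (val (bilinear i j)).
Proof. by apply: (@degltM 2 1) => W W1; rewrite gvar_homog // neq_ltn W1 orbT. Qed.

Lemma deglt_gconst c : deglt 1 (gconst c).
Proof. by move=> W W1; rewrite !ffunE; case: eqP W1 => [->|]; rewrite ?cards0 ?mulr0. Qed.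

Local Notation m := bilinear.

Lemma deglt_gone : deglt 1 (1 : galg).
Proof. by move=> W W1; rewrite ffunE; case: (W =P _) W1 => // ->; rewrite cards0. Qed.

Lemma deglt_prod (A : {set T}) (z : T -> evenalg) :
  (forall i, deglt 3 (val (z i))) -> deglt (2 * #|A|).+1 (val (\prod_(i in A) z i)).
Proof.
move=> z3; rewrite rmorph_prod -sum1_card big_distrr /=.
elim/big_rec2: _ => [|i y x iA IH]; first exact: deglt_gone.
exact: (degltM (a := 3) (z3 i) IH).
Qed.

Lemma deglt_mtau A : deglt (2 * #|A|).+1 (val (mtau m A)).
Proof. by apply: deglt_prod => i; apply: deglt_bilinear. Qed.

Lemma deglt_gdiff i j : deglt 3 (val (gdiff m i j)).
Proof.
rewrite /gdiff !(rmorphD, rmorphB) /=.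
by do !apply: degltD; do ?apply: degltN; apply: deglt_bilinear.
Qed.

Lemma lowdeg_gdiff i j : lowdeg 1 (val (gdiff m i j)).
Proof.
apply: (@lowdeg_sub 1 2) => //; rewrite /gdiff !(rmorphD, rmorphB) /=.
by do !apply: lowdegD; do ?apply: lowdegN; apply: lowdeg_bilinear.
Qed.

(** By [glueE] this is a product of #|A| - 1 factors of degree 2, so it falls short of the degree of
    [mtau A]. *)
Lemma deglt_glue A : A != set0 -> deglt (2 * #|A|) (val (glue m A)).
Proof.
case/set0Pn => r rA; rewrite (glueE bilinear_anti bilinear_row bilinear_col rA).
rewrite [X in (2 * X)%N](cardsD1 r) rA mulnDr.
by apply: (@deglt_sub (2 * #|A :\ r|).+1); [lia | apply: deglt_prod => i; apply: deglt_gdiff].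
Qed.

Lemma lowdeg1M x y : lowdeg 1 x -> lowdeg 1 (x * y).
Proof. by move=> x1; rewrite -[1%N]addn0; apply: lowdegM. Qed.

Lemma lowdeg_wglue A a : (1 < #|A|)%N -> lowdeg 1 (val (wglue m A a)).
Proof.
case/card_gt1P => r [s [rA sA nrs]].
rewrite (wglueE bilinear_anti bilinear_row bilinear_col _ rA).
rewrite (glueE bilinear_anti bilinear_row bilinear_col rA) (big_setD1 s); last by rewrite !inE eq_sym nrs.
by rewrite mulrCA rmorphM; apply/lowdeg1M/lowdeg_gdiff.
Qed.

(** A shares two vertices with itself. *)
Lemma wglue_sqr A a : (1 < #|A|)%N -> wglue m A a ^+ 2 = 0.
Proof.
case/card_gt1P => r [s [rA sA nrs]]; rewrite expr2.
exact: (wglue_mul0 bilinear_anti bilinear_row bilinear_col) nrs _ _ _ _.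
Qed.

Hypothesis fact_neq0 : forall k, (k`!%:R : K) != 0.
Local Notation texp := (texp (@econst) #|{: gen}|).

Lemma gscale_val c (x : evenalg) : gscale c (val x) = val (econst c * x).
Proof. by rewrite gscale_mul rmorphM. Qed.

Lemma gpow_val (x : evenalg) n : gpow (val x) n = val (x ^+ n).
Proof. by elim: n => [|n IHn] //; rewrite exprS rmorphM /= -[even_val (x ^+ n)]IHn. Qed.

Lemma gexp_val (x : evenalg) : gexp (val x) = val (texp x).
Proof.
rewrite rmorph_sum /gexp; apply: eq_bigr => k _.
by rewrite gpow_val gscale_val.
Qed.

Lemma texp_sum (I : Type) (r : seq I) (P : pred I) (z : I -> evenalg) (x : evenalg) :
  lowdeg 1 (val x) -> (forall i, P i -> lowdeg 1 (val (z i)) /\ z i ^+ 2 = 0) ->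
  texp (x + \sum_(i <- r | P i) z i) = texp x * \prod_(i <- r | P i) (1 + z i).
Proof.
move=> x1 Pz.
(* The partial sums must have no constant term: their power #|gen| times a further z i then has
   degree above the number of generators and vanishes, as [texpD] requires. *)
suff [] : lowdeg 1 (val (x + \sum_(i <- r | P i) z i)) /\
  texp (x + \sum_(i <- r | P i) z i) = texp x * \prod_(i <- r | P i) (1 + z i) by [].
elim/big_rec2: _ => [|i y s Pi [s1 IH]]; first by rewrite addr0 mulr1.
have [zi1 zi2] := Pz i Pi; rewrite addrCA addrC; split; first by rewrite rmorphD; apply: lowdegD.
rewrite texpD // ?IH; first by ring.
apply: val_inj; rewrite rmorphM rmorphXn; apply: lowdeg_eq0.
by rewrite -addn1; apply: lowdegM zi1; apply: lowdegX.
Qed.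

Lemma tauE A : tau K A = val (mtau m A).
Proof. by rewrite rmorph_prod. Qed.

Lemma bilinearE i j : gmul (gpsibar K i) (gpsi K j) = val (bilinear i j).
Proof. by []. Qed.

Lemma fAE lam A : fA lam A = val (wglue m A (econst (lam * (1 - #|A|%:R)))).
Proof.
rewrite /fA /wglue /glue rmorphD rmorphB !rmorph_sum -addrA addrC tauE.
congr (_ + _); last exact: gscale_val.
congr (_ - _); apply: eq_bigr => i _; first by rewrite tauE.
by rewrite rmorph_sum; apply: eq_bigr => j _; rewrite rmorphM tauE.
Qed.

Lemma mono_scale_mul x y (a b : K) S U : [disjoint S & U] ->
  (forall W, x W = a * mono S W) -> (forall W, y W = b * mono U W) ->
  forall W, (x * y) W = a * b * gsign K S U * mono (S :|: U) W.
Proof.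
move=> dSU xE yE W; rewrite -[RHS]mulrA -(gcoef_disj dSU) -mono_mulE.
rewrite (gmulE x) (gmulE (mono S)) mulr_sumr; apply: eq_bigr => P _.
rewrite mulr_sumr; apply: eq_bigr => Q _.
by rewrite xE yE; ring.
Qed.

(** The sign s depends on the order of the generators and is left unspecified; [berezin] divides by
    it, so only s != 0 matters. *)
Lemma mtau_mono A : exists2 s : K, s != 0 & forall W,
  val (mtau m A) W = s * mono [set g : gen | g.2 \in A] W.
Proof.
have [n] := ubnP #|A|; elim: n A => // n IHn A.
have [->|[i iA]] := set_0Vmem A => [_|].
  exists 1; rewrite ?oner_eq0 // => W; rewrite /mtau big_set0 rmorph1 !ffunE mul1r.
  by congr (_ == _)%:R; apply/setP => g; rewrite !inE.
rewrite (cardsD1 i) iA add1n ltnS => /IHn[s s0 sE].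
pose S := [set g : gen | g.2 \in A :\ i]; pose P : {set gen} := [set (false, i)] :|: [set (true, i)].
have dij : [disjoint [set (false, i)] & [set (true, i)]] by rewrite disjoints1 inE.
have dPS : [disjoint P & S].
  rewrite -setI_eq0; apply/eqP/setP => -[b j]; rewrite !inE /= !xpair_eqE.
  by case: b; case: (j =P i); rewrite ?andbF.
exists (gsign K [set (false, i)] [set (true, i)] * s * gsign K P S).
  by rewrite !mulf_neq0 ?s0 // gsignE signr_eq0.
have -> : [set g | g.2 \in A] = P :|: S.
  apply/setP => -[b j]; rewrite !inE /= !xpair_eqE.
  by case: b; case: (j =P i) => // ->; rewrite ?iA.
rewrite (@mtauD1 _ _ bilinear _ _ iA) rmorphM => W.
apply: mono_scale_mul dPS _ sE W => W.
by rewrite mono_mulE gcoef_disj.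
Qed.

Lemma berezin_tau_neq0 : tau K [set: T] [set: gen] != 0.
Proof.
have [s s0 sE] := mtau_mono setT; rewrite tauE sE ffunE.
rewrite (_ : [set g | _] = setT) ?eqxx ?mulr1 //.
by apply/setP => g; rewrite !inE.
Qed.

Lemma berezin_sum (I : Type) (r : seq I) (P : pred I) (z : I -> galg) :
  berezin (\sum_(i <- r | P i) z i) = \sum_(i <- r | P i) berezin (z i).
Proof. by rewrite /berezin sum_ffunE mulr_suml. Qed.

Lemma berezin_scale c x : berezin (gconst c * x) = c * berezin x.
Proof. by rewrite /berezin -gscale_mul ffunE mulrA. Qed.

Lemma berezin_prod_wglue (P : {set {set T}}) (nu : {set T} -> K) :
  partition P setT -> berezin (val (\prod_(C in P) wglue m C (econst (nu C)))) = \prod_(C in P) nu C.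
Proof.
case/and3P => /eqP cP tP P0.
pose y := \prod_(C in P) (econst (nu C) * mtau m C).
(* Replacing each factor by its part in [mtau C] changes only degrees below the top. The bound on y
   itself is carried along for the induction. *)
have [xy _] : deglt (\sum_(C in P) 2 * #|C|) (val (\prod_(C in P) wglue m C (econst (nu C))) - val y)
    /\ deglt (\sum_(C in P) 2 * #|C|).+1 (val y).
  rewrite /y; elim/big_rec3: _ => [|C y1 x1 d CP [xy1 yd1]].
    by split; [move=> W _; rewrite subrr ffunE | apply: deglt_gone].
  have C0 : C != set0 by apply: contraNneq P0 => <-.
  have cC : deglt (2 * #|C|).+1 (val (econst (nu C) * mtau m C)).
    by rewrite rmorphM -[X in deglt X]add1n; apply: degltM (@deglt_mtau C); apply: deglt_gconst.
  have bC : deglt (2 * #|C|) (val (wglue m C (econst (nu C))) - val (econst (nu C) * mtau m C)).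
    by rewrite -rmorphB /wglue addrK; apply: deglt_glue.
  split; last by rewrite rmorphM; apply: (degltM cC).
  rewrite !(rmorphM _ (wglue m _ _)) !(rmorphM _ (_ * _)).
  set u := val (wglue m _ _) in bC *; set v := val (_ * _) in bC cC *.
  (* In each summand one factor is a difference of smaller degree. *)
  have -> : u * val x1 - v * val y1 = (u - v) * val x1 + v * (val x1 - val y1).
    by rewrite mulrBl mulrBr addrA subrK.
  apply: degltD; last first.
    rewrite (geven_comm _ (valP _)) addnC; apply: degltM xy1 cC.
  apply: degltM bC _; rewrite -[val x1](subrK (val y1)); apply: degltD yd1.
  exact: deglt_sub xy1.
have sT : (\sum_(C in P) 2 * #|C| <= #|[set: gen]|)%N.
  by rewrite -big_distrr /= (eqP tP) cP !cardsT card_prod card_bool.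
have := xy setT sT; rewrite ffunE => /eqP; rewrite ffunE subr_eq0 /berezin => /eqP ->.
have -> : y = econst (\prod_(C in P) nu C) * mtau m setT.
  by rewrite /y big_split /= -rmorph_prod -cP /mtau big_trivIset.
by rewrite rmorphM /= -gscale_mul ffunE -tauE mulfK // berezin_tau_neq0.
Qed.

Lemma partition_components F : partition (components F) [set: T].
Proof.
apply/and3P; split; last 2 first.
- exact: trivIset_components.
- by apply/negP => /componentsP[x] /setP/(_ x); rewrite mem_hcomp inE.
by apply/eqP/setP => x; rewrite inE; apply/bigcupP; exists (hcomp F x); rewrite ?hcomp_in ?mem_hcomp.
Qed.

Lemma prod1D_subsets (R : comNzRingType) (E : {set {set T}}) (z : {set T} -> R) :
  \prod_(A in E) (1 + z A) = \sum_(F : {set {set T}} | F \subset E) \prod_(A in F) z A.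
Proof.
rewrite big_mkcond /=.
transitivity (\prod_A ((if A \in E then z A else 0) + 1)).
  by apply: eq_bigr => A _; case: ifP; rewrite ?add0r // addrC.
rewrite bigA_distr [RHS]big_mkcond /=; apply: eq_bigr => F _.
rewrite -big_mkcond /=; case: ifP => [/subsetP FE|/negbT/subsetPn[A AF nAE]].
  by apply: eq_bigr => A /FE ->.
by rewrite (bigD1 A) //= (negPf nAE) mul0r.
Qed.

Lemma berezin_hyperforests (E : {set {set T}}) (w lam : {set T} -> K) (t : T -> K) :
  is_hypergraph E ->
  berezin (gexp (\sum_i gscale (t i) (gmul (gpsibar K i) (gpsi K i))
                  + \sum_(A in E) gscale (w A) (fA (lam A) A)))
   = \sum_(F in spanning_forests E)
       (\prod_(A in F) w A) *
       \prod_(Cc in components F)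
         (\sum_(i in Cc) t i
          - \sum_(A in F | A \subset Cc) (#|A|%:R - 1) * lam A).
Proof.
move=> hE; pose c A := econst (lam A * (1 - #|A|%:R)).
pose z A := econst (w A) * wglue m A (c A).
(* The added 0 is the starting point for [texp_sum], which first peels off the hyperedge terms and
   then the vertex terms. *)
have -> : \sum_i gscale (t i) (gmul (gpsibar K i) (gpsi K i))
    + \sum_(A in E) gscale (w A) (fA (lam A) A) =
    val (0 + \sum_i econst (t i) * m i i + \sum_(A in E) z A).
  rewrite add0r rmorphD !rmorph_sum; congr (_ + _); apply: eq_bigr => i _.
    by rewrite bilinearE gscale_val.
  by rewrite fAE gscale_val.
have t1 i : lowdeg 1 (val (econst (t i) * m i i)) /\ (econst (t i) * m i i) ^+ 2 = 0.
  split; last by rewrite exprMn expr2 [m i i ^+ 2]expr2 bilinear_row mulr0.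
  by rewrite mulrC rmorphM; apply/lowdeg1M/(lowdeg_sub _ (@lowdeg_bilinear i i)).
rewrite gexp_val texp_sum; first last.
- move=> A AE; split; last by rewrite exprMn wglue_sqr ?mulr0 ?hE.
  by rewrite /z mulrC rmorphM; apply/lowdeg1M/lowdeg_wglue/hE.
- rewrite add0r rmorph_sum; elim/big_rec: _ => [W _|i x _ x1]; first by rewrite ffunE.
  by apply: lowdegD x1; case: (t1 i).
rewrite texp_sum //; last by move=> W _; rewrite ffunE.
rewrite texp0 mul1r prod1D_subsets mulr_sumr rmorph_sum berezin_sum.
rewrite [RHS](eq_bigl (fun F : {set {set T}} => (F \subset E) && `[< hyperforest F >])); last by move=> F; rewrite inE.
(* Both sides now run over all subsets of E, those with a cycle contributing 0. *)
rewrite [RHS]big_mkcondr; apply: eq_bigr => F FE.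
have hF : is_hypergraph F by move=> A /(subsetP FE)/hE.
rewrite /z big_split mulrCA -rmorph_prod (wglue_prod bilinear_anti bilinear_row bilinear_col) //.
rewrite rmorphM berezin_scale; case: asboolP => fF; last by rewrite rmorph0 /berezin ffunE mul0r mulr0.
congr (_ * _); rewrite -(berezin_prod_wglue _ (partition_components F)); congr (berezin (val _)).
apply: eq_bigr => C _; congr (wglue m C _); rewrite rmorphB !rmorph_sum; congr (_ + _).
by rewrite -sumrN; apply: eq_bigr => A _; rewrite -rmorphN; congr econst; ring.
Qed.

End GrassmannHyperforests.

(** * Equal parameters on all hyperedges, and the complex case *)

Lemma component_weight_const (T : finType) (K : fieldType) (F : {set {set T}}) (C : {set T})
    (t : T -> K) (l : K) :
  is_hypergraph F -> hyperforest F -> C \in components F ->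
  \sum_(i in C) t i - \sum_(A in F | A \subset C) (#|A|%:R - 1) * l = l + \sum_(i in C) (t i - l).
Proof.
(* The sum of |A| - 1 over the hyperedges of a hypertree is |C| - 1, so the subtracted term is l |C|
   - l. *)
move=> hF fF CF; rewrite sumrB sumr_const (card_component hF fF CF) -mulr_suml.
have -> : \sum_(A in F | A \subset C) (#|A|%:R - 1) = (\sum_(A in F | A \subset C) #|A|.-1)%:R :> K.
  rewrite natr_sum; apply: eq_bigr => A /andP[/hF A1 _].
  by rewrite -[#|A| in LHS]prednK ?(ltnW A1) // mulrSr addrK.
by rewrite -mulr_natl mulrSr; ring.
Qed.

Theorem theorem5p4 (R : realType) (T : finType) (E : {set {set T}})
    (w lam : {set T} -> R[i]) (t : T -> R[i]) :
  is_hypergraph E ->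
  (berezin (gexp (\sum_(i : T) gscale (t i) (gmul (gpsibar R[i] i) (gpsi R[i] i))
                  + \sum_(A in E) gscale (w A) (fA (lam A) A)))
   = \sum_(F in spanning_forests E)
       (\prod_(A in F) w A) *
       \prod_(Cc in components F)
         (\sum_(i in Cc) t i
          - \sum_(A in F | A \subset Cc) (#|A|%:R - 1) * lam A))
  /\
  (forall l : R[i],
   berezin (gexp (\sum_(i : T) gscale (t i) (gmul (gpsibar R[i] i) (gpsi R[i] i))
                  + \sum_(A in E) gscale (w A) (fA l A)))
   = \sum_(F in spanning_forests E)
       (\prod_(A in F) w A) *
       \prod_(Cc in components F) (l + \sum_(i in Cc) (t i - l))).
Proof.
move=> hE; have fact_neq0 k : (k`!%:R : R[i]) != 0 by rewrite pnatr_eq0 -lt0n fact_gt0.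
split=> [|l]; first exact: berezin_hyperforests.
rewrite (berezin_hyperforests fact_neq0 w (fun=> l) t hE); apply: eq_bigr => F.
rewrite inE => /andP[FE /asboolP fF]; congr (_ * _); apply: eq_bigr => C CF.
by apply: component_weight_const => // A /(subsetP FE)/hE.
Qed.
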